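(* Let $\Omega\subset\mathbb{O}\cong\mathbb{R}^8$ be open and let $f=\sum_{j=0}^7 f_je_j\colon\Omega\to\mathbb{O}$ be a componentwise differentiable function with real-valued components $f_0,\ldots,f_7$. Then $f$ is left monogenic in $\Omega$ (i.e. $\partial_xf=0$ in $\Omega$) if and only if $f_0,\ldots,f_7$ satisfy in $\Omega$ the following real $8\times 8$ system of partial differential equations: \[ \begin{cases} \partial_{x_0}f_0-\partial_{x_1}f_1-\partial_{x_2}f_2-\partial_{x_3}f_3-\partial_{x_4}f_4-\partial_{x_5}f_5-\partial_{x_6}f_6-\partial_{x_7}f_7=0\\ \partial_{x_0}f_1+\partial_{x_1}f_0+\partial_{x_2}f_3-\partial_{x_3}f_2+\partial_{x_4}f_5-\partial_{x_5}f_4-\partial_{x_6}f_7+\partial_{x_7}f_6=0\\ \partial_{x_0}f_2+\partial_{x_2}f_0-\partial_{x_1}f_3+\partial_{x_3}f_1+\partial_{x_4}f_6-\partial_{x_6}f_4+\partial_{x_5}f_7-\partial_{x_7}f_5=0\\ \partial_{x_0}f_3+\partial_{x_3}f_0+\partial_{x_1}f_2-\partial_{x_2}f_1+\partial_{x_4}f_7-\partial_{x_7}f_4-\partial_{x_5}f_6+\partial_{x_6}f_5=0\\ \partial_{x_0}f_4+\partial_{x_4}f_0-\partial_{x_1}f_5+\partial_{x_5}f_1-\partial_{x_2}f_6+\partial_{x_6}f_2-\partial_{x_3}f_7+\partial_{x_7}f_3=0\\ \partial_{x_0}f_5+\partial_{x_5}f_0+\partial_{x_1}f_4-\partial_{x_4}f_1-\partial_{x_2}f_7+\partial_{x_7}f_2+\partial_{x_3}f_6-\partial_{x_6}f_3=0\\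 \partial_{x_0}f_6+\partial_{x_6}f_0+\partial_{x_1}f_7-\partial_{x_7}f_1+\partial_{x_2}f_4-\partial_{x_4}f_2-\partial_{x_3}f_5+\partial_{x_5}f_3=0\\ \partial_{x_0}f_7+\partial_{x_7}f_0-\partial_{x_1}f_6+\partial_{x_6}f_1+\partial_{x_2}f_5-\partial_{x_5}f_2+\partial_{x_3}f_4-\partial_{x_4}f_3=0 \end{cases} \]
   Context: Let $\mathbb{H}$ be the quaternions with basis $\{1,i,j,k\}$, $i^2=j^2=k^2=ijk=-1$, and conjugation $a\mapsto\overline{a}$. The octonions $\mathbb{O}$ are $\mathbb{H}\oplus\mathbb{H}$ with the multiplication $(a,b)(c,d)=(ac-\overline{d}b,\ da+b\overline{c})$. A real basis of $\mathbb{O}$ is $e_0=1=(1,0)$, $e_1=(i,0)$, $e_2=(j,0)$, $e_3=(k,0)$, $e_4=(0,1)$, $e_5=(0,i)$, $e_6=(0,j)$, $e_7=(0,k)$. A point $x=\sum_{j=0}^7x_je_j\in\mathbb{O}$ is identified with $(x_0,\ldots,x_7)\in\mathbb{R}^8$. The Cauchy-Riemann operator is $\partial_x=\sum_{i=0}^7e_i\partial_{x_i}$, acting from the left by $\partial_xf=\sum_{i,j=0}^7e_ie_j\,\partial_{x_i}f_j$. *)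

(* Defs.v *)
From HB Require Import structures.
From mathcomp Require Import all_boot all_order all_algebra.
From mathcomp Require Import all_classical all_reals all_analysis.

Set Implicit Arguments.
Unset Strict Implicit.
Unset Printing Implicit Defensive.

Import Order.TTheory GRing.Theory Num.Theory.
Import numFieldNormedType.Exports.

Local Open Scope ring_scope.

(* Quaternions and octonions are carried by R^4 and R^8, so that the vector
   space structure, the topology and the differential calculus are those of
   the library; [row_mx a b] is the pair (a, b) of H (+) H.  Numerals used as
   indices below are elements of 'I_4 or 'I_8, e.g. [x 0 7] is x_7. *)
Notation quaternion R := 'rV[R]_4.
Notation octonion R := 'rV[R]_8.

Section Quaternion.
Context {R : comNzRingType}.
Implicit Types a b : quaternion R.

(* t + x i + y j + z k *)
Definition quat (t x y z : R) : quaternion R :=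
  \row_(n < 4) [:: t; x; y; z]`_n.

Definition qconj a : quaternion R :=
  quat (a 0 0) (- a 0 1) (- a 0 2) (- a 0 3).

Definition qmul a b : quaternion R :=
  quat (a 0 0 * b 0 0 - a 0 1 * b 0 1 - a 0 2 * b 0 2 - a 0 3 * b 0 3)
       (a 0 0 * b 0 1 + a 0 1 * b 0 0 + a 0 2 * b 0 3 - a 0 3 * b 0 2)
       (a 0 0 * b 0 2 - a 0 1 * b 0 3 + a 0 2 * b 0 0 + a 0 3 * b 0 1)
       (a 0 0 * b 0 3 + a 0 1 * b 0 2 - a 0 2 * b 0 1 + a 0 3 * b 0 0).

Definition q1 : quaternion R := quat 1 0 0 0.
Definition qi : quaternion R := quat 0 1 0 0.
Definition qj : quaternion R := quat 0 0 1 0.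
Definition qk : quaternion R := quat 0 0 0 1.

Lemma hamilton_relations :
  [/\ qmul qi qi = - q1, qmul qj qj = - q1, qmul qk qk = - q1
    & qmul (qmul qi qj) qk = - q1].
Proof.
by split; apply/rowP => -[[|[|[|[|//]]]] ?];
  rewrite !mxE /= ?(mulr0, mul0r, mulr1, mul1r, addr0, add0r, subr0, oppr0).
Qed.

End Quaternion.

Section Octonion.
Context {R : comNzRingType}.
Implicit Types x y : octonion R.

Definition opair (a b : quaternion R) : octonion R := row_mx a b.
Definition ofst x : quaternion R := @lsubmx R 1 4 4 x.
Definition osnd x : quaternion R := @rsubmx R 1 4 4 x.

(* (a, b) (c, d) = (a c - d^* b, d a + b c^* ) *)
Definition omul x y : octonion R :=
  let a := ofst x in let b := osnd x in
  let c := ofst y in let d := osnd y in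
  opair (qmul a c - qmul (qconj d) b) (qmul d a + qmul b (qconj c)).

Definition obasis (n : 'I_8) : octonion R := delta_mx 0 n.

Lemma obasisE :
  (obasis 0 = opair q1 0 /\ obasis 1 = opair qi 0 /\
   obasis 2 = opair qj 0 /\ obasis 3 = opair qk 0) /\
  (obasis 4 = opair 0 q1 /\ obasis 5 = opair 0 qi /\
   obasis 6 = opair 0 qj /\ obasis 7 = opair 0 qk).
Proof.
do !split; apply/rowP => n; rewrite !mxE;
  case: (@splitP 4 4 n) => -[m m4] /= nm; rewrite !mxE -val_eqE /= nm;
  by case: m m4 nm => [|[|[|[|]]]].
Qed.

End Octonion.

Section LeftMonogenic.
Context {R : realType}.
Implicit Types (f : octonion R -> octonion R) (x : octonion R).

(* f_n, the n-th real component of f *)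
Definition component f (n : 'I_8) : octonion R -> R := fun x => f x 0 n.

Lemma componentE f x : f x = \sum_(n < 8) component f n x *: obasis n.
Proof. exact: row_sum_delta. Qed.

Definition partial (m : 'I_8) (g : octonion R -> R) (x : octonion R) : R :=
  'D_(obasis m) g x.

Definition cauchy_riemann f x : octonion R :=
  \sum_(m < 8) \sum_(n < 8)
     partial m (component f n) x *: omul (obasis m) (obasis n).

(* Functions on Omega are total functions whose values off Omega are
   irrelevant: for Omega open, the partial derivatives at its points only
   depend on the restriction to Omega. *)
Definition left_monogenic (Omega : set (octonion R)) f : Prop :=
  forall x, Omega x -> cauchy_riemann f x = 0.

End LeftMonogenic.

(* Main.v *)
Require Import Defs.
From mathcomp Require Import all_boot all_order all_algebra.
From mathcomp Require Import all_classical all_reals all_analysis.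
From mathcomp Require Import ring.
Import Order.TTheory GRing.Theory Num.Theory.
Import numFieldNormedType.Exports.
Local Open Scope ring_scope.

(** The octonion product is bilinear, so its eight coordinates are eight linear
forms with coefficients 0, 1 and -1 in the sixty-four monomials x_m y_n.  The
operator is the same product with x_m y_n replaced by the derivative of f_n
along e_m, so the coordinates of its value are the same linear forms evaluated
at the Jacobian; they are the left-hand sides of the eight equations.  Hence
the octonion vanishes exactly when the system holds.

[octonion_forms] records the linear forms, [omul_forms] reads them off the
Cayley-Dickson product, and [forms_basis_expansion] passes from the monomials
to arbitrary coefficients.  The equivalence holds pointwise. *)

(** The bilinear map behind the product, linearised: a coefficient matrix
stands for a tensor x (x) y, so that the rank-one tensors and the Jacobian are
instances of the same argument. *)
Definition octonion_forms {R : comNzRingType} (D : 'I_8 -> 'I_8 -> R) :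
    octonion R :=
  \row_(k < 8)
    [:: D 0 0 - D 1 1 - D 2 2 - D 3 3 - D 4 4 - D 5 5 - D 6 6 - D 7 7;
        D 0 1 + D 1 0 + D 2 3 - D 3 2 + D 4 5 - D 5 4 - D 6 7 + D 7 6;
        D 0 2 + D 2 0 - D 1 3 + D 3 1 + D 4 6 - D 6 4 + D 5 7 - D 7 5;
        D 0 3 + D 3 0 + D 1 2 - D 2 1 + D 4 7 - D 7 4 - D 5 6 + D 6 5;
        D 0 4 + D 4 0 - D 1 5 + D 5 1 - D 2 6 + D 6 2 - D 3 7 + D 7 3;
        D 0 5 + D 5 0 + D 1 4 - D 4 1 - D 2 7 + D 7 2 + D 3 6 - D 6 3;
        D 0 6 + D 6 0 + D 1 7 - D 7 1 + D 2 4 - D 4 2 - D 3 5 + D 5 3;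
        D 0 7 + D 7 0 - D 1 6 + D 6 1 + D 2 5 - D 5 2 + D 3 4 - D 4 3]`_k.

Lemma ofstE {R : comNzRingType} (x : octonion R) :
  [/\ ofst x 0 0 = x 0 0, ofst x 0 1 = x 0 1,
      ofst x 0 2 = x 0 2 & ofst x 0 3 = x 0 3].
Proof. by split; rewrite mxE; congr (x _ _); apply/val_inj. Qed.

Lemma osndE {R : comNzRingType} (x : octonion R) :
  [/\ osnd x 0 0 = x 0 4, osnd x 0 1 = x 0 5,
      osnd x 0 2 = x 0 6 & osnd x 0 3 = x 0 7].
Proof. by split; rewrite mxE; congr (x _ _); apply/val_inj. Qed.

Lemma omul_forms {R : comNzRingType} (x y : octonion R) :
  omul x y = octonion_forms (fun m n => x 0 m * y 0 n).
Proof.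
rewrite /omul /=.
(* With the halves abstracted, mxE unfolds the quaternion operations only and
   leaves the coordinates indexed by numerals, as ring needs them. *)
move: (ofst x) (ofstE x) (osnd x) (osndE x) => a [a0 a1 a2 a3] b [b0 b1 b2 b3].
move: (ofst y) (ofstE y) (osnd y) (osndE y) => c [c0 c1 c2 c3] d [d0 d1 d2 d3].
apply/rowP => k; rewrite [RHS]mxE [LHS]mxE.
case: (@splitP 4 4 k) => -[m m4] /= ->;
  case: m m4 => [|[|[|[|//]]]] m4; rewrite !mxE /=;
  rewrite ?(a0, a1, a2, a3, b0, b1, b2, b3, c0, c1, c2, c3, d0, d1, d2, d3);
  ring.
Qed.

(** On a pair of basis vectors the monomials are Kronecker deltas, which pick
one coefficient out of each double sum. *)
Lemma sum_basis_monomial {R : comNzRingType} (D : 'I_8 -> 'I_8 -> R)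
    (a b : 'I_8) :
  \sum_(m < 8) \sum_(n < 8) D m n * (obasis m 0 a * obasis n 0 b) = D a b.
Proof.
rewrite (bigD1 a) //= [X in _ + X]big1 ?addr0 => [|m ma]; last first.
  by rewrite big1 // => n _; rewrite !mxE eqxx eq_sym (negbTE ma) mul0r mulr0.
rewrite (bigD1 b) //= big1 ?addr0 => [|n nb]; last first.
  by rewrite !mxE [b == n]eq_sym (negbTE nb) andbF !mulr0.
by rewrite !mxE !eqxx !mulr1.
Qed.

(** Both sides are linear in [D], and each coordinate on the left is a signed sum
of eight double sums evaluated by [sum_basis_monomial]. *)
Lemma forms_basis_expansion {R : comNzRingType} (D : 'I_8 -> 'I_8 -> R) :
  \sum_(m < 8) \sum_(n < 8) D m n *: omul (obasis m) (obasis n) =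
  octonion_forms D.
Proof.
apply/rowP => k; rewrite summxE.
under eq_bigr => m _ do
  (rewrite summxE; under eq_bigr => n _ do rewrite omul_forms 2!mxE).
rewrite mxE; case: k => -[|[|[|[|[|[|[|[|//]]]]]]]] k8 /=;
  under eq_bigr => m _ do
    (under eq_bigr => n _ do rewrite !(mulrDr, mulrN);
     rewrite !(big_split, sumrN) /=);
  by rewrite !(big_split, sumrN) /= !sum_basis_monomial.
Qed.

Lemma octonion_forms_eq0 {R : comNzRingType} (D : 'I_8 -> 'I_8 -> R) :
  octonion_forms D = 0 <->
  D 0 0 - D 1 1 - D 2 2 - D 3 3 - D 4 4 - D 5 5 - D 6 6 - D 7 7 = 0 /\
  D 0 1 + D 1 0 + D 2 3 - D 3 2 + D 4 5 - D 5 4 - D 6 7 + D 7 6 = 0 /\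
  D 0 2 + D 2 0 - D 1 3 + D 3 1 + D 4 6 - D 6 4 + D 5 7 - D 7 5 = 0 /\
  D 0 3 + D 3 0 + D 1 2 - D 2 1 + D 4 7 - D 7 4 - D 5 6 + D 6 5 = 0 /\
  D 0 4 + D 4 0 - D 1 5 + D 5 1 - D 2 6 + D 6 2 - D 3 7 + D 7 3 = 0 /\
  D 0 5 + D 5 0 + D 1 4 - D 4 1 - D 2 7 + D 7 2 + D 3 6 - D 6 3 = 0 /\
  D 0 6 + D 6 0 + D 1 7 - D 7 1 + D 2 4 - D 4 2 - D 3 5 + D 5 3 = 0 /\
  D 0 7 + D 7 0 - D 1 6 + D 6 1 + D 2 5 - D 5 2 + D 3 4 - D 4 3 = 0.
Proof.
split=> [/rowP forms0 | [d0 [d1 [d2 [d3 [d4 [d5 [d6 d7]]]]]]]].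
  do !split.
  - by have := forms0 0; rewrite !mxE.
  - by have := forms0 1; rewrite !mxE.
  - by have := forms0 2; rewrite !mxE.
  - by have := forms0 3; rewrite !mxE.
  - by have := forms0 4; rewrite !mxE.
  - by have := forms0 5; rewrite !mxE.
  - by have := forms0 6; rewrite !mxE.
  - by have := forms0 7; rewrite !mxE.
by apply/rowP => -[[|[|[|[|[|[|[|[|//]]]]]]]] k8]; rewrite !mxE.
Qed.

Theorem mainTheorem1 (R : realType) (Omega : set (octonion R))
    (f : octonion R -> octonion R)
    (openOmega : open Omega)
    (diff_f : forall (x : octonion R) (n : 'I_8),
       Omega x -> differentiable (component f n) x) :
  left_monogenic Omega f <->
  (forall x : octonion R, Omega x ->
     let D (m n : 'I_8) : R := partial m (component f n) x in
     D 0 0 - D 1 1 - D 2 2 - D 3 3 - D 4 4 - D 5 5 - D 6 6 - D 7 7 = 0 /\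
     D 0 1 + D 1 0 + D 2 3 - D 3 2 + D 4 5 - D 5 4 - D 6 7 + D 7 6 = 0 /\
     D 0 2 + D 2 0 - D 1 3 + D 3 1 + D 4 6 - D 6 4 + D 5 7 - D 7 5 = 0 /\
     D 0 3 + D 3 0 + D 1 2 - D 2 1 + D 4 7 - D 7 4 - D 5 6 + D 6 5 = 0 /\
     D 0 4 + D 4 0 - D 1 5 + D 5 1 - D 2 6 + D 6 2 - D 3 7 + D 7 3 = 0 /\
     D 0 5 + D 5 0 + D 1 4 - D 4 1 - D 2 7 + D 7 2 + D 3 6 - D 6 3 = 0 /\
     D 0 6 + D 6 0 + D 1 7 - D 7 1 + D 2 4 - D 4 2 - D 3 5 + D 5 3 = 0 /\
     D 0 7 + D 7 0 - D 1 6 + D 6 1 + D 2 5 - D 5 2 + D 3 4 - D 4 3 = 0).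
Proof.
split=> [mono x Ox D | system x Ox].
  by apply/octonion_forms_eq0; rewrite -forms_basis_expansion; exact: mono.
by rewrite /cauchy_riemann forms_basis_expansion; apply/octonion_forms_eq0/system.
Qed.
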